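(* Suppose $Z_S^0\tilde A_{S,F}=c_1\mathbf 1$ and $\mathbf 1\tilde A_F=c_2\mathbf 1$ for some constants $c_1,c_2\in[0,1]$. Suppose that either (i) the reinforcement is of non-Pólya type, that is, $R\ne mI$ and $a+b>0$; or (ii) $S\ne\emptyset$ and for every $f\in F$ there exists $s\in S$ such that $s\rightsquigarrow f$. Then, as $t\to\infty$, $$Z_F^t\xrightarrow{a.s.}\frac{(1-b)+(a+b-1)c_1}{1-(a+b-1)c_2}\,\mathbf 1.$$ In particular, when the reinforcement is of non-Pólya type and $S=\emptyset$, then as $t\to\infty$ $$Z_F^t\xrightarrow{a.s.}\frac{1-b}{2-a-b}\,\mathbf 1.$$
   Context: Graph. $G=(V,E)$ is a finite directed graph with $V=\{1,\dots,N\}$ and $E\subseteq V\times V$. Write $i\to j$ if $(i,j)\in E$, and $i\rightsquigarrow j$ if there is a directed path from $i$ to $j$. Let $V(i)=\{j\in V:(j,i)\in E\}$, $d_i^{\mathrm{in}}=|V(i)|$, $d_i^{\mathrm{out}}=|\{j:(i,j)\in E\}|$. There are no isolated vertices (no $i$ with $d_i^{\mathrm{in}}=d_i^{\mathrm{out}}=0$). Put $S=\{i:d_i^{\mathrm{in}}=0\}$ (stubborn vertices) and $F=\{i:d_i^{\mathrm{in}}>0\}$ (flexible vertices), with vertices ordered so that $F=\{1,\dots,|F|\}$. Urn process. At each vertex $i$ there is an urn with $W_i^t$ white and $B_i^t$ black balls at time $t\ge 0$; the initial configuration is fixed, with $T_i^0:=W_i^0+B_i^0\ge 1$. Fix a positive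 integer $m$ and $\alpha,\beta\in\{0,1,\dots,m\}$, and put $R=\begin{pmatrix}\alpha & m-\alpha\\ m-\beta&\beta\end{pmatrix}$, $a=\alpha/m$, $b=\beta/m$. Let $Z_i^t=W_i^t/(W_i^t+B_i^t)$, $Z^t=(Z_1^t,\dots,Z_N^t)$ and $\mathcal F_t=\sigma(Z^0,\dots,Z^t)$. At time $t+1$ a ball is drawn uniformly at random from every urn (and put back); $Y_i^{t+1}$ is the indicator that the ball drawn from urn $i$ is white. Conditionally on $\mathcal F_t$, the $Y_i^{t+1}$, $i\in V$, are independent with $P(Y_i^{t+1}=1\mid\mathcal F_t)=Z_i^t$. Then for every $i\in V$ $$W_i^{t+1}=W_i^t+\sum_{j\in V(i)}\left[\alpha Y_j^{t+1}+(m-\beta)(1-Y_j^{t+1})\right],\qquad B_i^{t+1}=B_i^t+\sum_{j\in V(i)}\left[(m-\alpha) Y_j^{t+1}+\beta(1-Y_j^{t+1})\right].$$ In particular urns in $S$ never change. Notation. Vectors are row vectors; $Z^t=(Z_F^t,Z_S^0)$, where a subscript denotes restriction to that index set. $\mathbf 1$ is an all-ones row vector of appropriate dimension and $I$ an identity matrix. $\tilde A$ is the $N\times N$ scaled adjacency matrix with $\tilde A_{i,j}=1/d_j^{\mathrm{in}}$ if $i\to j$, and $0$ otherwise; $\tilde A_F$ is its $F\times F$ block and $\tilde A_{S,F}$ its block with rows in $S$ and columns in $F$. If $S=\emptyset$, the term $Z_S^0\tilde A_{S,F}$ is $\mathbf 0$. *)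

(* Defs.v *)
From HB Require Import structures.
From mathcomp Require Import all_boot all_order all_algebra.
From mathcomp Require Import all_classical all_reals all_analysis.

Set Implicit Arguments.
Unset Strict Implicit.
Unset Printing Implicit Defensive.

Import Order.TTheory GRing.Theory Num.Theory.
Import numFieldNormedType.Exports.

Local Open Scope classical_set_scope.
Local Open Scope ring_scope.

Section Graph.
Variables (N : nat) (E : rel 'I_N).

Definition in_nbrs (i : 'I_N) : {set 'I_N} := [set j : 'I_N | E j i]%SET.
Definition out_nbrs (i : 'I_N) : {set 'I_N} := [set j : 'I_N | E i j]%SET.
Definition indeg (i : 'I_N) : nat := #|in_nbrs i|.
Definition outdeg (i : 'I_N) : nat := #|out_nbrs i|.

Definition no_isolated_vertex : Prop :=
  forall i, ~ (indeg i = 0%N /\ outdeg i = 0%N).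

Definition stubborn : {set 'I_N} := [set i : 'I_N | indeg i == 0%N]%SET.
Definition flexible : {set 'I_N} := [set i : 'I_N | (0 < indeg i)%N]%SET.

Definition scaled_adj (R : realType) : 'M[R]_N :=
  \matrix_(i, j) (if E i j then (indeg j)%:R^-1 else 0).

End Graph.

(* Restriction to index sets; enum_val lists them in increasing order. *)
Definition mx_block (R : realType) (N : nat) (I J : {set 'I_N}) (A : 'M[R]_N) :
    'M[R]_(#|I|, #|J|) :=
  mxsub (fun k : 'I_#|I| => enum_val k) (fun k : 'I_#|J| => enum_val k) A.

Definition rV_restrict (R : realType) (N : nat) (I : {set 'I_N})
    (v : 'rV[R]_N) : 'rV[R]_#|I| :=
  colsub (fun k : 'I_#|I| => enum_val k) v.

Definition reinforcement_mx (m alpha beta : nat) : 'M[nat]_2 :=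
  \matrix_(i < 2, j < 2)
    if i == 0 then (if j == 0 then alpha else (m - alpha)%N)
    else (if j == 0 then (m - beta)%N else beta).

Definition non_Polya (R : realType) (m alpha beta : nat) : Prop :=
  reinforcement_mx m alpha beta <> m%:M
  /\ 0 < alpha%:R / m%:R + beta%:R / m%:R :> R.

Section Conditioning.
Context (R : realType) (d : measure_display) (T : measurableType d)
  (P : probability T R).

(* g is a version of the conditional probability P(A | G). *)
Definition is_cond_prob (G : set_system T) (A : set T) (g : T -> R) : Prop :=
  [/\ preimage_set_system setT g measurable `<=` G,
      P.-integrable setT (EFin \o g) &
      forall D, G D -> (\int[P]_(x in D) (g x)%:E = P (A `&` D))%E].

(* Taking B i = setT for some of the indices yields the product rule for
   subfamilies. *)
Definition cond_independent (G : set_system T) (N : nat)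
    (X : 'I_N -> T -> bool) : Prop :=
  forall (B : 'I_N -> set bool) (g : 'I_N -> T -> R),
    (forall i, is_cond_prob G (X i @^-1` B i) (g i)) ->
    is_cond_prob G (\bigcap_i (X i @^-1` B i)) (fun x => \prod_i g i x).

End Conditioning.

Section Urns.
Context (R : realType) (d : measure_display) (T : measurableType d)
  (P : probability T R).
Variables (N : nat) (E : rel 'I_N) (m alpha beta : nat).
Variables (W0 B0 : 'I_N -> nat).

(* Y t i x: the ball drawn from urn i at time t is white (Y 0 is not used). *)
Variable Y : nat -> 'I_N -> {RV P >-> bool}.

Fixpoint white (t : nat) (i : 'I_N) (x : T) : nat :=
  if t is s.+1 then
    (white s i x + \sum_(j in in_nbrs E i)
      (alpha * Y s.+1 j x + (m - beta) * (1 - Y s.+1 j x)))%N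
  else W0 i.

Fixpoint black (t : nat) (i : 'I_N) (x : T) : nat :=
  if t is s.+1 then
    (black s i x + \sum_(j in in_nbrs E i)
      ((m - alpha) * Y s.+1 j x + beta * (1 - Y s.+1 j x)))%N
  else B0 i.

Definition urn_prop (t : nat) (i : 'I_N) (x : T) : R :=
  (white t i x)%:R / (white t i x + black t i x)%N%:R.

Definition urn_row (t : nat) (x : T) : 'rV[R]_N := \row_i urn_prop t i x.

Definition initial_row : 'rV[R]_N := \row_i ((W0 i)%:R / (W0 i + B0 i)%N%:R).

Definition urn_filtration (t : nat) : set_system T :=
  <<s \bigcup_(s in [set s | (s <= t)%N])
        \bigcup_i preimage_set_system setT (urn_prop s i) measurable >>.

Definition urn_draws : Prop :=
  forall t,
    cond_independent P (urn_filtration t) (fun i => Y t.+1 i : T -> bool) /\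
    forall i, is_cond_prob P (urn_filtration t) [set x | Y t.+1 i x = true]
                (urn_prop t i).

(* Almost sure convergence of Z_F^t to the constant vector l 1. *)
Definition flexible_cvg_as (l : R) : Prop :=
  {ae P, forall x,
    rV_restrict (flexible E) (urn_row t x) @[t --> \oo]
      --> (const_mx l : 'rV[R]_#|flexible E|)}.

End Urns.

(* Main.v *)
(* Put [rho = a + b - 1].  The number of white balls of an urn grows at each
   step by an affine function of the proportions of its in-neighbours, of slope
   [rho] (times [m]), plus an increment orthogonal to the past.  The sums [S_n]
   of these bounded increments satisfy ['E[S_n ^+ 2] = O(n)], so [S_n / n] tends
   to 0 almost surely: along squares because
   [\sum_k 'E[(S_(k ^ 2) / k ^ 2) ^+ 2]] is finite, and in between because the
   increments are bounded.

   The two hypotheses on the graph make the constant vector [l] a fixed point of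
   the mean dynamics, and the sup-norm distance of [Z_F] to [l] at time [t] is,
   up to [o(1)], at most [q = |rho| c2] times its average over the times before
   [t].  In case (i) [|rho| < 1]; in case (ii) some flexible vertex has a
   stubborn in-neighbour, so its column sum, which is [c2], is less than 1.
   Thus [q < 1] in both cases and the distance tends to 0. *)

Require Import Defs.
From HB Require Import structures.
From mathcomp Require Import all_boot all_order all_algebra.
From mathcomp Require Import all_classical all_reals all_analysis.
From mathcomp Require Import measurable_realfun ring lra zify.

Set Implicit Arguments.
Unset Strict Implicit.
Unset Printing Implicit Defensive.

Import Order.TTheory GRing.Theory Num.Theory.
Import numFieldNormedType.Exports.

Local Open Scope classical_set_scope.
Local Open Scope ring_scope.

(** * Deterministic limits of real sequences *)

Lemma exists_sqrtn (n : nat) : exists k, (k ^ 2 <= n < k.+1 ^ 2)%N.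
Proof.
elim: n => [|n [k /andP[kn nk]]]; first by exists 0%N.
have [lt|ge] := ltnP n.+1 (k.+1 ^ 2); first by exists k; lia.
by exists k.+1; nia.
Qed.

(** If [k ^ 2 <= n < k.+1 ^ 2], then [n] exceeds [k ^ 2] by at most [2 * k], so [s] moves by at most
    [2 * k * C] in between, which is negligible against [n >= k ^ 2]. *)
Lemma cvg_mean_of_squares (R : realType) (s : R^nat) (C : R) :
  (forall n, `|s n.+1 - s n| <= C) ->
  s (k ^ 2)%N / (k ^ 2)%:R @[k --> \oo] --> 0 ->
  s n / n%:R @[n --> \oo] --> 0.
Proof.
move=> sC sq0.
have gap n j : `|s (n + j)%N - s n| <= C * j%:R.
  elim: j => [|j IH]; first by rewrite addn0 subrr normr0 mulr0.
  rewrite addnS -natr1 mulrDr mulr1.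
  rewrite (le_trans (ler_distD (s (n + j)%N) _ _))// addrC.
  by apply: lerD.
have C0 : 0 <= C by apply: le_trans (sC 0%N).
apply/cvgr0Pnorm_le => e e0.
have e20 : 0 < e / 2 by rewrite divr_gt0.
move/cvgr0Pnorm_le : sq0 => /(_ _ e20)[K _ sqK].
(* From [k >= K] comes [|s (k ^ 2)| <= e / 2 * k ^ 2]; from [k >= 4 * C / e] comes
   [2 * k * C <= e / 2 * k ^ 2]. *)
pose L := (maxn K (Num.truncn (4 * C / e)).+1).+1.
exists (L ^ 2)%N => // n /= Ln.
have [k /andP[kn nk]] := exists_sqrtn n.
have Lk : (L <= k)%N by move: Ln nk kn; nia.
have k0 : 0 < k%:R :> R by rewrite ltr0n; apply: leq_trans Lk.
have n0 : 0 < n%:R :> R by rewrite ltr0n; move: Ln; rewrite /L; nia.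
have Kk : (K <= k)%N by rewrite (leq_trans _ Lk)// leqW// leq_maxl.
have := sqK k Kk; rewrite /= normrM normfV normr_nat.
rewrite ler_pdivrMr; last by rewrite natrX exprn_gt0.
move=> sk.
have Cek : 4 * C <= e * k%:R.
  rewrite [leRHS]mulrC -ler_pdivrMr// ltW// (lt_le_trans (truncnS_gt _))//.
  by rewrite ler_nat; apply: leq_trans Lk; rewrite /L leqW// leq_maxr.
rewrite normrM normfV normr_nat ler_pdivrMr//.
have := gap (k ^ 2)%N (n - k ^ 2)%N; rewrite subnKC// => g.
have : (n - k ^ 2)%:R <= 2 * k%:R :> R.
  by rewrite -natrM ler_nat; move: nk; nia.
move=> /(ler_wpM2l C0) h.
have kn' : (k ^ 2)%:R <= n%:R :> R by rewrite ler_nat.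
have := ler_normD (s n - s (k ^ 2)%N) (s (k ^ 2)%N); rewrite subrK => tri.
have : k%:R * (4 * C) <= k%:R * (e * k%:R) :> R by rewrite ler_wpM2l// ltW.
have : e * (k ^ 2)%:R <= e * n%:R by rewrite ler_wpM2l// ltW.
move: sk; rewrite !natrX.
by nra.
Qed.

(* An eventual bound [c] on [v] improves to [r * c] with [q < r < 1]. *)
Lemma averaged_contraction_cvg0 (R : realType) (v e : R^nat) (q K : R) :
  0 <= q < 1 -> (forall n, 0 <= v n <= K) -> e n @[n --> \oo] --> 0 ->
  (forall n, (0 < n)%N -> v n <= q * ((\sum_(s < n) v s) / n%:R) + e n) ->
  v n @[n --> \oo] --> 0.
Proof.
move=> /andP[q0 q1] vK e0 ve.
have K0 : 0 <= K by have /andP[/le_trans] := vK 0%N; apply.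
(* If [K] is 0 then [v] vanishes; otherwise [K] is a positive bound from which [step] can be
   iterated. *)
have {K0}[K0|Kpos] : 0 = K \/ 0 < K.
  by move: K0; rewrite le_eqVlt => /orP[/eqP|]; [left|right].
  rewrite (_ : v = fun=> 0); first exact: cvg_cst.
  by apply/funext => n; apply/le_anti; rewrite andbC [X in _ <= _ <= X]K0.
have K0 := ltW Kpos.
pose r := (1 + q) / 2.
have [qr r1] : q < r /\ r < 1 by rewrite /r; lra.
have r0 : 0 < r by lra.
have step c : 0 < c -> (\forall n \near \oo, v n <= c) ->
    \forall n \near \oo, v n <= r * c.
  move=> c0 [n0 _ vc].
  (* Terms before [n0] cost at most [K] each, later ones at most [c]. *)
  have sumc n : \sum_(s < n) v s <= n0%:R * K + n%:R * c.
    elim: n => [|n IH]; first by rewrite big_ord0 mul0r addr0 mulr_ge0.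
    rewrite big_ord_recr/= -natr1 mulrDl mul1r addrA.
    have [lt|/vc/=] := ltnP n n0; last by move/(lerD IH).
    have : \sum_(s < n) v s <= n%:R * K.
      rewrite -[leRHS](_ : \sum_(s < n) K = _).
        by apply: ler_sum => i _; case/andP: (vK i).
      by rewrite sumr_const card_ord mulr_natl.
    have /andP[_ vnK] := vK n.
    have : n.+1%:R <= n0%:R :> R by rewrite ler_nat.
    move=> /(ler_wpM2r K0); rewrite -natr1 mulrDl mul1r => h1 h2.
    have : 0 <= n%:R * c by rewrite mulr_ge0// ltW.
    by lra.
  (* The slack [(r - q) * c] is halved: one half absorbs the initial terms of the average, the other
     [e n], so that the total is at most [q * c + (r - q) * c = r * c]. *)
  have d0 : 0 < (r - q) * c / 2 by rewrite divr_gt0// mulr_gt0// subr_gt0.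
  move/cvgr0Pnorm_le : e0 => /(_ _ d0) [n1 _ e1].
  pose n2 := (Num.truncn (n0%:R * K / ((r - q) * c / 2))).+1.
  exists (maxn n1 n2) => // n /=; rewrite geq_max => /andP[/e1/= en n2n].
  have npos : 0 < n%:R :> R by rewrite ltr0n (leq_trans _ n2n).
  have : n0%:R * K / ((r - q) * c / 2) <= n%:R.
    by rewrite ltW// (lt_le_trans (truncnS_gt _))// ler_nat.
  rewrite ler_pdivrMr// => n0n.
  have avg : (\sum_(s < n) v s) / n%:R <= c + (r - q) * c / 2.
    rewrite ler_pdivrMr// (le_trans (sumc n))//.
    by move: n0n; lra.
  apply: (le_trans (ve n _)); first by rewrite (leq_trans _ n2n).
  have := ler_wpM2l q0 avg; move: (ler_norm (e n)) => en'.
  have : q * ((r - q) * c / 2) <= (r - q) * c / 2 by rewrite ler_piMl// ltW.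
  by nra.
have rk k : \forall n \near \oo, v n <= r ^+ k * K.
  elim: k => [|k IH].
    by exists 0%N => // n _; rewrite expr0 mul1r; case/andP: (vK n).
  by rewrite exprS -mulrA; apply: step IH; rewrite mulr_gt0// exprn_gt0.
apply/cvgr0Pnorm_le => eps eps0.
have : r ^+ k * K @[k --> \oo] --> 0.
  rewrite -[X in _ --> X](mul0r K); apply: cvgMl.
  by apply: cvg_expr; rewrite ger0_norm ?ltW.
move=> /cvgr0Pnorm_le/(_ _ eps0)[k _ /(_ k (leqnn k))/= rke].
near=> n.
have /andP[vn _] := vK n; rewrite ger0_norm//.
apply: le_trans (le_trans (ler_norm _) rke).
by near: n; exact: rk.
Unshelve. all: by end_near. Qed.

(** * A strong law for bounded orthogonal increments *)

Section BoundedMeasurable.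
Context (R : realType) (d : measure_display) (T : measurableType d).
Implicit Types f g : T -> R.

(** This class is closed under sums and products and integrable for every probability, so
    integrability conditions reduce to closure properties. *)
Definition bounded_measurable f :=
  measurable_fun setT f /\ exists M, forall x, `|f x| <= M.

Lemma eq_bounded_measurable f g : f =1 g ->
  bounded_measurable g -> bounded_measurable f.
Proof. by move/funext => ->. Qed.

Lemma bounded_measurable_cst (c : R) : bounded_measurable (fun=> c).
Proof. by split; [exact: measurable_cst|exists `|c|]. Qed.

Lemma bounded_measurableD f g : bounded_measurable f ->
  bounded_measurable g -> bounded_measurable (fun x => f x + g x).
Proof.
move=> [mf [M fM]] [mg [M' gM]]; split; first exact: measurable_funD.
by exists (M + M') => x; rewrite (le_trans (ler_normD _ _))// lerD.
Qed.

Lemma bounded_measurableM f g : bounded_measurable f ->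
  bounded_measurable g -> bounded_measurable (fun x => f x * g x).
Proof.
move=> [mf [M fM]] [mg [M' gM]]; split; first exact: measurable_funM.
by exists (M * M') => x; rewrite normrM ler_pM.
Qed.

Lemma bounded_measurableZ (c : R) f : bounded_measurable f ->
  bounded_measurable (fun x => c * f x).
Proof. exact/bounded_measurableM/bounded_measurable_cst. Qed.

Lemma bounded_measurable_sum (I : Type) (r : seq I) (Q : pred I)
    (F : I -> T -> R) : (forall i, Q i -> bounded_measurable (F i)) ->
  bounded_measurable (fun x => \sum_(i <- r | Q i) F i x).
Proof.
move=> bF; elim: r => [|i r IH].
  apply: (eq_bounded_measurable (fun=> big_nil _ _ _ _)).
  exact: bounded_measurable_cst.
apply: (eq_bounded_measurable (fun=> big_cons _ _ _ _ _ _)).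
by case: (Q i) (bF i) => [/(_ isT) ?|_] //; exact: bounded_measurableD.
Qed.

Lemma bounded_measurable_indic (A : set T) : measurable A ->
  bounded_measurable (\1_A).
Proof.
move=> mA; split; first exact: measurable_indic.
by exists 1 => x; rewrite indicE ger0_norm// lern1 leq_b1.
Qed.

Section Integral.
Variable mu : probability T R.

Lemma bounded_measurable_integrable (D : set T) f :
  measurable D -> bounded_measurable f -> mu.-integrable D (EFin \o f).
Proof.
move=> mD [mf [M fM]]; apply: measurable_bounded_integrable => //.
- by rewrite (le_lt_trans (probability_le1 _ _))// ltry.
- exact: measurable_funTS.
- exists M; split; first exact: num_real.
  by move=> M' MM' x _; rewrite /= (le_trans (fM x))// ltW.
Qed.

Lemma bounded_measurable_Rintegral_sum (I : Type) (r : seq I)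
    (F : I -> T -> R) : (forall i, bounded_measurable (F i)) ->
  \int[mu]_x (\sum_(i <- r) F i x) = \sum_(i <- r) \int[mu]_x F i x.
Proof.
move=> bF; elim: r => [|i r IH].
  rewrite big_nil (eq_Rintegral _ (g := fun=> 0)).
    by rewrite Rintegral_cst// mul0r.
  by move=> x _; rewrite big_nil.
rewrite big_cons -IH -RintegralD//; try exact: bounded_measurable_integrable.
  by apply: eq_Rintegral => x _; rewrite big_cons.
by apply: bounded_measurable_integrable => //; exact: bounded_measurable_sum.
Qed.

End Integral.

End BoundedMeasurable.

Lemma sum_inv_sqr_le2 (R : realType) (n : nat) :
  \sum_(k < n) (k.+1 ^ 2)%:R^-1 <= 2 :> R.
Proof.
(* The induction needs this telescoping bound; with [k = n + 1], each step leaves the slack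
   [1 / (k * (k + 1) ^ 2)]. *)
suff h : \sum_(k < n.+1) (k.+1 ^ 2)%:R^-1 <= 2 - n.+1%:R^-1 :> R.
  rewrite big_ord_recr/= in h.
  rewrite (le_trans _ (le_trans h _))// ?lerDl ?invr_ge0//.
  by rewrite gerBl invr_ge0.
elim: n => [|n IH]; first by rewrite big_ord_recr big_ord0/= exp1n invr1; lra.
rewrite big_ord_recr/= (le_trans (lerD IH (lexx _)))//.
rewrite -subr_ge0 natrX -[n.+2%:R]natr1.
have : n.+1%:R != 0 :> R by rewrite pnatr_eq0.
have : n.+1%:R + 1 != 0 :> R by rewrite natr1 pnatr_eq0.
have : 0 <= n.+1%:R :> R by [].
move: n.+1%:R => k k0 k1 kn0.
rewrite [X in 0 <= X](_ : _ = (k * (k + 1) ^+ 2)^-1).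
  by rewrite invr_ge0 mulr_ge0// sqr_ge0.
by field; rewrite kn0 k1.
Qed.

Section OrthogonalIncrements.
Context (R : realType) (d : measure_display) (T : measurableType d)
  (P : probability T R).
Variables (S : nat -> T -> R) (C : R).
Hypothesis bS : forall n, bounded_measurable (S n).
Hypothesis S0 : forall x, S 0 x = 0.
Hypothesis SC : forall n x, `|S n.+1 x - S n x| <= C.
Hypothesis orthS : forall n, \int[P]_x (S n x * (S n.+1 x - S n x)) = 0.

(** In the expansion of [(S n + D) ^ 2] the cross term integrates to 0 by [orthS], so each step adds
    at most [C ^ 2] to the second moment. *)
Lemma orthogonal_increments_sqr n :
  \int[P]_x (S n x ^+ 2) <= n%:R * C ^+ 2.
Proof.
have bi f : bounded_measurable f -> P.-integrable setT (EFin \o f).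
  exact: bounded_measurable_integrable.
elim: n => [|n IH].
  rewrite mul0r (eq_Rintegral _ (g := fun=> 0)); last first.
    by move=> x _; rewrite S0 expr0n.
  by rewrite Rintegral_cst// mul0r.
pose D x := S n.+1 x - S n x.
have bD : bounded_measurable D.
  apply: bounded_measurableD => //.
  apply: (eq_bounded_measurable (fun x => esym (mulN1r _))).
  exact: bounded_measurableZ.
rewrite (eq_Rintegral _ (g := fun x => S n x * S n x + 2 * (S n x * D x) +
  D x * D x)); last by move=> x _; rewrite /D; ring.
have bSD := bounded_measurableM (bS n) bD.
have bSS := bounded_measurableM (bS n) (bS n).
have b2SD := bounded_measurableZ 2 bSD.
rewrite RintegralD//; [|apply: bi; exact: bounded_measurableD
  |apply: bi; exact: bounded_measurableM].
rewrite RintegralD//; [|exact: bi..].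
rewrite RintegralZl//; last exact: bi.
rewrite /D orthS mulr0 addr0 -natr1 mulrDl mul1r lerD//.
have -> : C ^+ 2 = \int[P]_x (C ^+ 2).
  have PT : fine (P setT) = 1 by rewrite probability_setT.
  by rewrite Rintegral_cst// [fine _]PT mulr1.
apply: le_Rintegral => //.
- by apply: bi; exact: bounded_measurableM.
- by apply: bi; exact: bounded_measurable_cst.
- move=> x _; rewrite -expr2 -real_normK ?num_real// lerXn2r ?nnegrE//.
  exact: le_trans (SC n x).
Qed.

(** The squares of [S (k ^ 2) / k ^ 2] have integrals at most [C ^ 2 / k ^ 2]. Their series
    therefore has a finite integral, hence a finite sum almost surely, and its terms tend to 0,
    which is the limit along squares. *)
Lemma orthogonal_increments_slln :
  {ae P, forall x, S n x / n%:R @[n --> \oo] --> 0}.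
Proof.
(* The index [k.+1] avoids a zero denominator. *)
pose f k x := (S (k.+1 ^ 2)%N x / (k.+1 ^ 2)%:R) ^+ 2.
have bf k : bounded_measurable (f k).
  by apply: bounded_measurableM; apply: bounded_measurableM => //;
    exact: bounded_measurable_cst.
have intf k : (\int[P]_x (f k x)%:E <= ((k.+1 ^ 2)%:R^-1 * C ^+ 2)%:E)%E.
  have -> : (\int[P]_x (f k x)%:E = (\int[P]_x f k x)%:E)%E.
    rewrite fineK// integrable_fin_num//.
    exact: (bounded_measurable_integrable P measurableT (bf k)).
  rewrite lee_fin.
  rewrite (eq_Rintegral _ (g := fun x => (k.+1 ^ 2)%:R ^- 2 *
    S (k.+1 ^ 2)%N x ^+ 2)); last first.
    by move=> x _; rewrite /f exprMn exprVn mulrC.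
  rewrite RintegralZl//; last first.
    apply: bounded_measurable_integrable => //.
    exact: bounded_measurableM.
  rewrite (le_trans (ler_wpM2l _ (orthogonal_increments_sqr _)))//.
  by rewrite mulrA expr2 invfM mulfVK.
have sumf : (\int[P]_x (\sum_(0 <= k <oo) (f k x)%:E) < +oo)%E.
  rewrite integral_nneseries//; last 2 first.
  - by move=> k; apply/measurable_EFinP; case: (bf k).
  - by move=> k x _; rewrite lee_fin sqr_ge0.
  apply: (@le_lt_trans _ _ (2 * C ^+ 2)%:E); last exact: ltry.
  apply: lime_le.
    apply: is_cvg_nneseries => k _ _; apply: integral_ge0 => x _.
    by rewrite lee_fin sqr_ge0.
  apply: nearW => n; apply: le_trans (lee_sum _ (fun k _ => intf k)) _.
  rewrite sumEFin lee_fin big_mkord -mulr_suml ler_wpM2r ?sqr_ge0//.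
  exact: sum_inv_sqr_le2.
have mf : measurable_fun setT (fun x => (\sum_(0 <= k <oo) (f k x)%:E)%E).
  apply: (@ge0_emeasurable_sum _ _ _ _ (fun k x => (f k x)%:E) xpredT)
    => [k x _ _|k _]; first by rewrite lee_fin sqr_ge0.
  by apply/measurable_EFinP; case: (bf k).
have : P.-integrable setT (fun x => (\sum_(0 <= k <oo) (f k x)%:E)%E).
  apply/integrableP; split => //.
  rewrite (eq_integral (fun x => \sum_(0 <= k <oo) (f k x)%:E)%E)//.
  move=> x _; rewrite gee0_abs// nneseries_ge0// => k _ _.
  by rewrite lee_fin sqr_ge0.
move/integrable_ae => /(_ measurableT); apply: filterS => x /(_ I) finx.
apply: (@cvg_mean_of_squares _ _ C) => //.
have : f k x @[k --> \oo] --> 0.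
  apply: cvg_series_cvg_0; apply: nnseries_is_cvg => [k|].
    by rewrite sqr_ge0.
  by rewrite ltey_eq finx.
(* [f] is a squared ratio, so the threshold for it is [e ^ 2]; its index shift turns [K] into
   [K.+1]. *)
move=> /cvgr0Pnorm_lt f0; apply/cvgr0Pnorm_lt => e e0.
have e20 : 0 < e ^+ 2 by rewrite exprn_gt0.
have [K _ Kf] := f0 _ e20.
exists K.+1 => // -[|k]//= Kk.
have := Kf k Kk; rewrite /= /f normrX.
by rewrite ltr_pXn2r ?nnegrE ?normr_ge0 ?ltW.
Qed.

End OrthogonalIncrements.

(** * Orthogonality to the past from conditional probabilities *)

Section ConditionalOrthogonality.
Context (R : realType) (d : measure_display) (T : measurableType d)
  (P : probability T R).
Variables (G : set_system T) (A : set T) (p : T -> R).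
Hypothesis mA : measurable A.
Hypothesis bp : bounded_measurable p.
Hypothesis condA : is_cond_prob P G A p.

Let bAp : bounded_measurable (fun x => \1_A x - p x).
Proof.
apply: bounded_measurableD; first exact: bounded_measurable_indic.
apply: (eq_bounded_measurable (fun x => esym (mulN1r _))).
exact: bounded_measurableZ.
Qed.

Lemma cond_prob_orthogonal_indic (D : set T) : G D -> measurable D ->
  \int[P]_x (\1_D x * (\1_A x - p x)) = 0.
Proof.
move=> GD mD.
rewrite (eq_Rintegral _ (g := (fun x => \1_A x - p x) \_ D)); last first.
  move=> x _; rewrite patchE indicE.
  by case: (x \in D); rewrite ?mul1r ?mul0r.
have [_ _ /(_ D GD) intp] := condA.
rewrite -Rintegral_mkcond RintegralB//; last 2 first.
- apply: bounded_measurable_integrable => //.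
  exact: bounded_measurable_indic.
- exact: bounded_measurable_integrable.
by rewrite /Rintegral intp integral_indic// subrr.
Qed.

(** As [Z] has finitely many values, it is a finite combination of indicators of its level sets,
    which lie in [G]; no passage to a limit occurs. *)
Lemma cond_prob_orthogonal (Z : T -> R) (s : seq R) :
  uniq s -> (forall x, Z x \in s) ->
  (forall c, G (Z @^-1` [set c])) ->
  (forall c, measurable (Z @^-1` [set c])) ->
  \int[P]_x (Z x * (\1_A x - p x)) = 0.
Proof.
move=> us Zs GZ mZ.
rewrite (eq_Rintegral _ (g := fun x => \sum_(c <- s)
  c * (\1_(Z @^-1` [set c]) x * (\1_A x - p x)))); last first.
  move=> x _; have ind c : \1_(Z @^-1` [set c]) x = (Z x == c)%:R :> R.
    by rewrite indicE; congr ((nat_of_bool _)%:R); apply/idP/eqP; rewrite inE.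
  rewrite (bigD1_seq (Z x))//= ind eqxx mul1r big1 ?addr0// => c cZ.
  by rewrite ind eq_sym (negbTE cZ) mul0r mulr0.
have bi c : bounded_measurable
    (fun x => \1_(Z @^-1` [set c]) x * (\1_A x - p x)).
  by apply: bounded_measurableM => //; exact: bounded_measurable_indic.
rewrite bounded_measurable_Rintegral_sum; last first.
  by move=> c; exact: bounded_measurableZ.
rewrite big1// => c _; rewrite RintegralZl//.
  by rewrite cond_prob_orthogonal_indic// mulr0.
exact: bounded_measurable_integrable.
Qed.

End ConditionalOrthogonality.

Section OrthogonalTo.
Context (R : realType) (d : measure_display) (T : measurableType d)
  (P : probability T R).
Variable D : T -> R.
Hypothesis bD : bounded_measurable D.

Definition orthogonal_to (f : T -> R) :=
  bounded_measurable f /\ \int[P]_x (f x * D x) = 0.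

Lemma orthogonal_toD f g : orthogonal_to f -> orthogonal_to g ->
  orthogonal_to (fun x => f x + g x).
Proof.
move=> [bf f0] [bg g0]; split; first exact: bounded_measurableD.
rewrite (eq_Rintegral _ (g := fun x => f x * D x + g x * D x)); last first.
  by move=> x _; rewrite mulrDl.
rewrite RintegralD ?f0 ?g0 ?addr0//;
  by apply: bounded_measurable_integrable => //; exact: bounded_measurableM.
Qed.

Lemma orthogonal_toZ c f : orthogonal_to f -> orthogonal_to (fun x => c * f x).
Proof.
move=> [bf f0]; split; first exact: bounded_measurableZ.
rewrite (eq_Rintegral _ (g := fun x => c * (f x * D x))); last first.
  by move=> x _; rewrite mulrA.
rewrite RintegralZl ?f0 ?mulr0//.
by apply: bounded_measurable_integrable => //; exact: bounded_measurableM.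
Qed.

Lemma orthogonal_to_sum (I : Type) (r : seq I) (Q : pred I) (F : I -> T -> R) :
  (forall i, Q i -> orthogonal_to (F i)) ->
  orthogonal_to (fun x => \sum_(i <- r | Q i) F i x).
Proof.
move=> oF; elim: r => [|i r IH].
  split.
    apply: (eq_bounded_measurable (fun=> big_nil _ _ _ _)).
    exact: bounded_measurable_cst.
  rewrite (eq_Rintegral _ (g := fun=> 0)).
    by rewrite Rintegral_cst// mul0r.
  by move=> x _; rewrite big_nil mul0r.
rewrite [X in orthogonal_to X](_ : _ = fun x => if Q i then
  F i x + \sum_(j <- r | Q j) F j x else \sum_(j <- r | Q j) F j x); last first.
  by apply/funext => x; rewrite big_cons.
by case: (Q i) (oF i) => [/(_ isT) ?|_] //; exact: orthogonal_toD.
Qed.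

End OrthogonalTo.

(** * The urn process *)

Section Urn.
Context (R : realType) (d : measure_display) (T : measurableType d)
  (P : probability T R).
Variables (N : nat) (E : rel 'I_N) (m alpha beta : nat).
Hypotheses (hm : (0 < m)%N) (halpha : (alpha <= m)%N) (hbeta : (beta <= m)%N).
Variables (W0 B0 : 'I_N -> nat).
Hypothesis hT0 : forall i, (1 <= W0 i + B0 i)%N.
Variable Y : nat -> 'I_N -> {RV P >-> bool}.
Hypothesis hY : urn_draws E m alpha beta W0 B0 Y.

Let Z t i x : R := urn_prop E m alpha beta W0 B0 Y t i x.
Let total t i : nat := (W0 i + B0 i + t * (m * indeg E i))%N.
(** A drawn ball sends [c0 + kappa * y] white balls along each outgoing edge, with [y] equal to 1
    for white and 0 for black; [kappa] is [m * (a + b - 1)]. *)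
Let c0 : R := (m - beta)%:R.
Let kappa : R := alpha%:R - (m - beta)%:R.
Let innov t j x : R := (Y t.+1 j x)%:R - Z t j x.

(** A drawn ball of either colour adds [m] balls in all, so urn sizes are deterministic and the
    white count is a nonrandom multiple of [Z]. *)
Lemma white_black t i x :
  (white E m alpha beta W0 Y t i x + black E m alpha beta B0 Y t i x)%N
  = total t i.
Proof.
elim: t => [|t IH]; first by rewrite /total mul0n addn0.
rewrite /= addnACA IH -big_split/= /total mulSn.
rewrite (eq_bigr (fun=> m)) => [|j _]; last by case: (Y _ _ _) => /=; lia.
by rewrite sum_nat_const -/(indeg E i); lia.
Qed.

Let total_gt0 t i : 0 < (total t i)%:R :> R.
Proof. by rewrite ltr0n ltn_addr. Qed.

Let whiteE t i x :
  (white E m alpha beta W0 Y t i x)%:R = (total t i)%:R * Z t i x.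
Proof.
by rewrite /Z /urn_prop white_black mulrC divfK// gt_eqF.
Qed.

Lemma urn_prop_itv t i x : 0 <= Z t i x <= 1.
Proof.
rewrite /Z /urn_prop divr_ge0//= white_black ler_pdivrMr// mul1r.
by rewrite ler_nat -(white_black t i x) leq_addr.
Qed.

Lemma urn_prop_stubborn t i x : i \in stubborn E ->
  Z t i x = (W0 i)%:R / (W0 i + B0 i)%:R.
Proof.
rewrite inE cards_eq0 => /eqP i0; rewrite /Z /urn_prop.
by elim: t => //= t IH; rewrite i0 !big_set0 !addn0.
Qed.

Lemma urn_prop_bounded_measurable t i : bounded_measurable (Z t i).
Proof.
split; last first.
  by exists 1 => x; have /andP[z0 z1] := urn_prop_itv t i x; rewrite ger0_norm.
(* Measurability of [Z t i] is read off the integrability clause of [is_cond_prob]. *)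
have [_ /(_ i)[_ /integrableP[mZ _] _]] := hY t.
exact/measurable_EFinP.
Qed.

Lemma urn_innovation_bounded_measurable t j : bounded_measurable (innov t j).
Proof.
have -> : innov t j = fun x => \1_[set x | Y t.+1 j x = true] x + -1 * Z t j x.
  apply/funext => x; rewrite mulN1r /innov indicE.
  congr ((nat_of_bool _)%:R - _).
  by apply/idP/idP; rewrite inE.
apply: bounded_measurableD; last first.
  exact/bounded_measurableZ/urn_prop_bounded_measurable.
apply: bounded_measurable_indic.
rewrite -[X in measurable X]setTI.
exact: (measurable_funPT (Y t.+1 j) measurableT [set true]).
Qed.

Lemma urn_prop_filtration s t i (B : set R) : measurable B -> (s <= t)%N ->
  urn_filtration E m alpha beta W0 B0 Y t (Z s i @^-1` B).
Proof.
move=> mB st; apply: sub_sigma_algebra; exists s => //; exists i => //.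
by exists B => //; rewrite setTI.
Qed.

Lemma urn_prop_orthogonal s t i j : (s <= t)%N ->
  orthogonal_to P (innov t j) (Z s i).
Proof.
move=> st; split; first exact: urn_prop_bounded_measurable.
have [_ /(_ j) condY] := hY t.
rewrite (eq_Rintegral _ (g := fun x => Z s i x *
  (\1_[set x | Y t.+1 j x = true] x - Z t j x))); last first.
  move=> x _; rewrite /innov indicE; congr (_ * ((nat_of_bool _)%:R - _)).
  by apply/idP/idP; rewrite inE.
(* With a deterministic total, the possible values are the fractions [k / total]; duplicates are
   removed to make the list [uniq]. *)
apply: (cond_prob_orthogonal _ _ condY (s := undup
    [seq k%:R / (total s i)%:R | k <- iota 0 (total s i).+1])).
- rewrite -[X in measurable X]setTI.
  exact: (measurable_funPT (Y t.+1 j) measurableT [set true]).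
- exact: urn_prop_bounded_measurable.
- exact: undup_uniq.
- move=> x; rewrite mem_undup; apply/mapP.
  exists (white E m alpha beta W0 Y s i x).
    by rewrite mem_iota/= ltnS -(white_black s i x) leq_addr.
  by rewrite -(white_black s i x).
- by move=> c; exact: urn_prop_filtration.
- move=> c; rewrite -[X in measurable X]setTI.
  by have [mZ _] := urn_prop_bounded_measurable s i; exact: mZ.
Qed.

Lemma cst_orthogonal t j (c : R) : orthogonal_to P (innov t j) (fun=> c).
Proof.
have [_ /(_ j) condY] := hY t.
have -> : (fun=> c) = fun x : T => c * \1_[set: T] x.
  by apply/funext => x; rewrite indicT mulr1.
apply: orthogonal_toZ; first exact: urn_innovation_bounded_measurable.
split; first exact: bounded_measurable_indic.
rewrite (eq_Rintegral _ (g := fun x => \1_[set: T] x *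
  (\1_[set x | Y t.+1 j x = true] x - Z t j x))); last first.
  move=> x _; rewrite /innov !indicE; congr (_ * ((nat_of_bool _)%:R - _)).
  by apply/idP/idP; rewrite inE.
apply: (cond_prob_orthogonal_indic _ _ condY) => //.
- rewrite -[X in measurable X]setTI.
  exact: (measurable_funPT (Y t.+1 j) measurableT [set true]).
- exact: urn_prop_bounded_measurable.
(* The full set belongs to the filtration as the preimage of [setT] under [Z t j]. *)
- exact: (urn_prop_filtration (s := t) j measurableT).
Qed.

(** The martingale part of the white count: the initial value and the conditional mean increments
    are subtracted. *)
Let noise i t x : R := (white E m alpha beta W0 Y t i x)%:R - (W0 i)%:R
  - \sum_(s < t) \sum_(j in in_nbrs E i) (c0 + kappa * Z s j x).

Let noiseS i t x :
  noise i t.+1 x - noise i t x = kappa * \sum_(j in in_nbrs E i) innov t j x.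
Proof.
rewrite /noise/= big_ord_recr/= natrD natr_sum.
rewrite [LHS](_ : _ = \sum_(j in in_nbrs E i)
  (alpha * Y t.+1 j x + (m - beta) * (1 - Y t.+1 j x))%:R -
  \sum_(j in in_nbrs E i) (c0 + kappa * Z t j x)); last by ring.
rewrite -sumrB mulr_sumr; apply: eq_bigr => j _.
rewrite /kappa /c0 /innov; case: (Y _ _ _) => /=.
  by rewrite subnn muln0 addn0 muln1; ring.
by rewrite muln0 add0n subn0 muln1; ring.
Qed.

(** Since totals are deterministic, [noise i s] is an affine combination of proportions at times up
    to [s], each orthogonal to [innov t j]. *)
Let noise_orthogonal i s t j : (s <= t)%N ->
  orthogonal_to P (innov t j) (noise i s).
Proof.
move=> st; have bD := urn_innovation_bounded_measurable t j.
rewrite [noise i s](_ : _ = fun x =>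
    ((total s i)%:R * Z s i x + - (W0 i)%:R) +
    -1 * \sum_(s' < s) \sum_(k in in_nbrs E i) (c0 + kappa * Z s' k x));
  last first.
  by apply/funext => x; rewrite /noise whiteE mulN1r.
apply: orthogonal_toD => //.
  apply: orthogonal_toD => //; last exact: cst_orthogonal.
  exact/orthogonal_toZ/urn_prop_orthogonal.
apply: orthogonal_toZ => //; apply: orthogonal_to_sum => // s' _.
apply: orthogonal_to_sum => // k _; apply: orthogonal_toD => //.
  exact: cst_orthogonal.
apply: orthogonal_toZ => //; apply: urn_prop_orthogonal.
exact: leq_trans (ltnW (ltn_ord s')) st.
Qed.

(** Each innovation lies in [[-1, 1]], whence the bound [|kappa| * indeg] on the increments. *)
Let noise_slln i : {ae P, forall x, noise i t x / t%:R @[t --> \oo] --> 0}.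
Proof.
apply: (@orthogonal_increments_slln _ _ _ P (noise i)
  (`|kappa| * (indeg E i)%:R)).
- by move=> t; have [] := noise_orthogonal i i (leqnn t).
- by move=> x; rewrite /noise big_ord0/= subrr subr0.
- move=> t x; rewrite noiseS normrM ler_wpM2l//.
  rewrite (le_trans (ler_norm_sum _ _ _))//.
  rewrite (le_trans (ler_sum _ (G := fun=> 1) _))//; last first.
    by rewrite sumr_const.
  move=> j _; have := urn_prop_itv t j x; rewrite ler_norml /innov.
  by case: (Y _ _ _) => /=; lra.
- move=> t.
  rewrite (eq_Rintegral _ (g := fun x => kappa *
    \sum_(j in in_nbrs E i) (noise i t x * innov t j x))); last first.
    by move=> x _; rewrite noiseS mulrCA; congr (_ * _); rewrite mulr_sumr.
  have bni j : bounded_measurable (fun x => noise i t x * innov t j x).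
    apply: bounded_measurableM; last exact: urn_innovation_bounded_measurable.
    by have [] := noise_orthogonal i j (leqnn t).
  rewrite RintegralZl//; last first.
    apply: bounded_measurable_integrable => //.
    exact: bounded_measurable_sum.
  under eq_Rintegral do rewrite -big_enum/=.
  rewrite bounded_measurable_Rintegral_sum// big1 ?mulr0// => j _.
  by have [] := noise_orthogonal i j (leqnn t).
Qed.

(** * Contraction along one sample path *)

Section Path.
Variables c1 c2 l : R.
Hypothesis kc : `|kappa| * c2 < m%:R.
Hypothesis c2_ge0 : 0 <= c2.
Hypothesis c1E : forall i, i \in flexible E ->
  \sum_(j in in_nbrs E i | j \in stubborn E) ((W0 j)%:R / (W0 j + B0 j)%:R)
  = c1 * (indeg E i)%:R.
Hypothesis c2E : forall i, i \in flexible E ->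
  \sum_(j in in_nbrs E i | j \in flexible E) 1 = c2 * (indeg E i)%:R.
Hypothesis lE : c0 + kappa * (c1 + c2 * l) = m%:R * l.

(** The sup-norm distance of [Z_F] to [l]; the default 0 covers an empty flexible set. *)
Let dev t x : R := \big[Num.max/0]_(i in flexible E) `|Z t i x - l|.

(** By [c1E], [c2E] and [lE], the constant terms and the stubborn in-neighbours cancel against
    [m * indeg * l]. What remains is [kappa] times the deviations of the flexible in-neighbours, of
    which there are [c2 * indeg]. *)
Let drift_le i t x : i \in flexible E ->
  `|\sum_(j in in_nbrs E i) (c0 + kappa * Z t j x) -
    m%:R * (indeg E i)%:R * l| <= `|kappa| * c2 * (indeg E i)%:R * dev t x.
Proof.
move=> iF.
have splitF f : \sum_(j in in_nbrs E i) f j =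
    \sum_(j in in_nbrs E i | j \in stubborn E) f j +
    \sum_(j in in_nbrs E i | j \in flexible E) f j :> R.
  rewrite (bigID (mem (stubborn E)))/=; congr (_ + _).
  by apply: eq_bigl => j; rewrite !inE lt0n.
have -> : \sum_(j in in_nbrs E i) (c0 + kappa * Z t j x) -
    m%:R * (indeg E i)%:R * l =
    kappa * \sum_(j in in_nbrs E i | j \in flexible E) (Z t j x - l).
  rewrite big_split/= sumr_const -mulr_sumr splitF.
  rewrite (eq_bigr (fun j => (W0 j)%:R / (W0 j + B0 j)%:R)); last first.
    by move=> j /andP[_ /urn_prop_stubborn].
  rewrite c1E// sumrB.
  have -> : \sum_(j in in_nbrs E i | j \in flexible E) l =
      c2 * (indeg E i)%:R * l.
    by rewrite -c2E// mulr_suml; apply: eq_bigr => j _; rewrite mul1r.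
  by rewrite -/(indeg E i) -mulr_natl mulrAC -lE; ring.
rewrite normrM -!mulrA ler_wpM2l// mulrA -c2E// mulr_suml.
rewrite (le_trans (ler_norm_sum _ _ _))//; apply: ler_sum => j /andP[_ jF].
by rewrite mul1r; exact: (le_bigmax_cond _ (fun j => `|Z t j x - l|)).
Qed.

(** [total * (Z - l)] is the initial deviation plus the noise plus the accumulated drift. Division
    by [t * m * indeg] puts [dev] in the form required by [averaged_contraction_cvg0]. *)
Lemma urn_path_cvg x : (forall i, noise i t x / t%:R @[t --> \oo] --> 0) ->
  forall i, i \in flexible E -> Z t i x @[t --> \oo] --> l.
Proof.
move=> noise0.
pose err i t := `|(W0 i)%:R - (W0 i + B0 i)%:R * l| / t%:R +
  `|noise i t x / t%:R|.
(* Summing over all vertices gives a single error term that serves every vertex in the maximum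
   [dev]. *)
have errE : \sum_(i < N) err i t @[t --> \oo] --> 0.
  rewrite [X in _ --> X](_ : _ = \sum_(i < N) (0 : R)); last by rewrite big1_eq.
  apply: cvg_big => [|i _]; first exact: add_continuous.
   rewrite -[X in _ --> X](addr0 0); apply: cvgD.
    rewrite -[X in _ --> X](mulr0 `|(W0 i)%:R - (W0 i + B0 i)%:R * l|).
    apply: cvgM; first exact: cvg_cst.
    apply/cvgr0Pnorm_le => e e0; near=> n.
    rewrite normfV normr_nat invf_ple ?posrE//; last first.
      rewrite ltr0n; near: n; exact: nbhs_infty_gt.
    near: n; exact: nbhs_infty_ger.
  by rewrite -[X in _ --> X](@normr0 _ R); apply: cvg_norm; exact: noise0.
have dev0 : dev t x @[t --> \oo] --> 0.
  apply: (averaged_contraction_cvg0 (q := `|kappa| * c2 / m%:R)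
    (K := 1 + `|l|) _ _ errE).
  - rewrite divr_ge0 ?mulr_ge0//=.
    by rewrite ltr_pdivrMr ?ltr0n// mul1r.
  - move=> t; rewrite bigmax_ge_id/=; apply: bigmax_le => [|i _].
      by rewrite addr_ge0.
    rewrite (le_trans (ler_normB _ _))// lerD2r.
    by have /andP[z0 z1] := urn_prop_itv t i x; rewrite ger0_norm.
  - move=> t t0; apply: bigmax_le => [|i iF].
      rewrite addr_ge0//.
        rewrite mulr_ge0 ?divr_ge0 ?mulr_ge0// sumr_ge0// => s _.
        exact: bigmax_ge_id.
      by rewrite sumr_ge0// => i _; rewrite addr_ge0// divr_ge0.
    have di : 1 <= (indeg E i)%:R :> R by rewrite ler1n; rewrite inE in iF.
    have tp : 0 < t%:R :> R by rewrite ltr0n.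
    have mp : 0 < m%:R :> R by rewrite ltr0n.
    have tot : (total t i)%:R =
        (W0 i + B0 i)%:R + t%:R * (m%:R * (indeg E i)%:R) :> R.
      by rewrite /total natrD !natrM.
    have key : (total t i)%:R * `|Z t i x - l| <=
        `|(W0 i)%:R - (W0 i + B0 i)%:R * l| + `|noise i t x| +
        `|kappa| * c2 * (indeg E i)%:R * \sum_(s < t) dev s x.
      rewrite -[X in X * _](ger0_norm (ltW (total_gt0 t i))) -normrM.
      have -> : (total t i)%:R * (Z t i x - l) =
          ((W0 i)%:R - (W0 i + B0 i)%:R * l) + noise i t x +
          \sum_(s < t) (\sum_(j in in_nbrs E i) (c0 + kappa * Z s j x) -
            m%:R * (indeg E i)%:R * l).
        rewrite mulrBr -whiteE sumrB sumr_const card_ord -mulr_natl tot /noise.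
        by ring.
      rewrite (le_trans (ler_normD _ _))// lerD ?ler_normD//.
      rewrite (le_trans (ler_norm_sum _ _ _))// mulr_sumr.
      by apply: ler_sum => s _; exact: drift_le.
    apply: (@le_trans _ _ (`|kappa| * c2 / m%:R *
      ((\sum_(s < t) dev s x) / t%:R) + err i t)); last first.
      rewrite lerD2l (bigD1 i)//= lerDl sumr_ge0// => k _.
      by rewrite addr_ge0// divr_ge0.
    (* This product is the total without the initial balls, hence a lower bound for it. *)
    have Tp : 0 < t%:R * (m%:R * (indeg E i)%:R) :> R.
      by rewrite !mulr_gt0// (lt_le_trans ltr01).
    rewrite -(ler_pM2l Tp); apply: le_trans (le_trans key _).
      by rewrite ler_wpM2r// tot lerDr.
    rewrite /err normrM normfV normr_nat.
    set u := `|_ - _|; set v := `|noise _ _ _|; set D := \sum_(s < t) _.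
    have -> : t%:R * (m%:R * (indeg E i)%:R) *
        (`|kappa| * c2 / m%:R * (D / t%:R) + (u / t%:R + v / t%:R)) =
        `|kappa| * c2 * (indeg E i)%:R * D + m%:R * (indeg E i)%:R * (u + v).
      by field; rewrite !gt_eqF.
    (* The factor [m * indeg] is at least 1, so it only enlarges [u + v]. *)
    rewrite addrC lerD2l ler_peMl//; first by apply: addr_ge0; exact: normr_ge0.
    by rewrite -natrM ler1n muln_gt0 hm; rewrite inE in iF.
move=> i iF; apply/cvgrPdistC_le => e e0.
move/cvgr0Pnorm_le : dev0 => /(_ _ e0); apply: filterS => t.
apply: le_trans; rewrite (le_trans _ (ler_norm _))//.
by exact: (le_bigmax_cond _ (fun j => `|Z t j x - l|)).
Unshelve. all: by end_near. Qed.

Lemma urn_cvg_as : {ae P, forall x, forall i, i \in flexible E ->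
  Z t i x @[t --> \oo] --> l}.
Proof.
have : {ae P, forall x, forall i, noise i t x / t%:R @[t --> \oo] --> 0}.
  by apply: filter_forall => i; exact: noise_slln.
by apply: filterS => x; exact: urn_path_cvg.
Qed.

End Path.
End Urn.

(** * From the matrix hypotheses to sums over in-neighbours *)

Section GraphWeights.
Context (R : realType) (N : nat) (E : rel 'I_N).

Lemma rV_restrict_mul_block (I J : {set 'I_N}) (v : 'rV[R]_N) (A : 'M[R]_N)
    (c : R) (j : 'I_N) : j \in J ->
  rV_restrict I v *m mx_block I J A = const_mx c ->
  \sum_(i in I) v 0 i * A i j = c.
Proof.
move=> jJ /rowP/(_ (enum_rank_in jJ j)); rewrite !mxE => <-.
by rewrite big_enum_val; apply: eq_bigr => i _; rewrite !mxE enum_rankK_in.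
Qed.

(** All nonzero entries of column [j] equal [1 / indeg], so multiplying by the in-degree leaves a
    plain sum. *)
Lemma sum_in_nbrs_block (I : {set 'I_N}) (v : 'rV[R]_N) (c : R) (j : 'I_N) :
  j \in flexible E ->
  rV_restrict I v *m mx_block I (flexible E) (scaled_adj E R) = const_mx c ->
  \sum_(i in in_nbrs E j | i \in I) v 0 i = c * (indeg E j)%:R.
Proof.
move=> jF /(rV_restrict_mul_block jF) <-.
have dj : (indeg E j)%:R != 0 :> R.
  by rewrite pnatr_eq0 -lt0n; rewrite inE in jF.
rewrite mulr_suml [LHS]big_mkcond [RHS]big_mkcond/=.
apply: eq_bigr => i _; rewrite !inE mxE.
by case: (i \in I); case: (E i j) => /=; rewrite ?mulr0 ?mul0r// divfK.
Qed.

(* The first edge of a path from a stubborn to a flexible vertex enters a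
   flexible vertex with a stubborn in-neighbour. *)
Lemma reachable_from_stubborn (s f : 'I_N) :
  s \in stubborn E -> f \in flexible E -> connect E s f ->
  exists2 g, g \in flexible E & E s g.
Proof.
move=> sS fF /connectP[[|g p]/= Esp fE].
  by move: sS fF; rewrite fE !inE lt0n => ->.
move: Esp => /andP[Esg _]; exists g => //; rewrite inE /indeg card_gt0.
by apply/set0Pn; exists s; rewrite inE.
Qed.

(** At a flexible vertex [g] entered directly from [s], the flexible in-neighbours form a proper
    subset of all in-neighbours; the common constant is compared with 1 there. *)
Lemma flexible_weight_lt1 (c : R) (s f : 'I_N) :
  s \in stubborn E -> f \in flexible E -> connect E s f ->
  (forall i, i \in flexible E ->
    \sum_(j in in_nbrs E i | j \in flexible E) 1 = c * (indeg E i)%:R) ->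
  c < 1.
Proof.
move=> sS fF sf cE; have [g gF Esg] := reachable_from_stubborn sS fF sf.
have dg : 0 < (indeg E g)%:R :> R by rewrite ltr0n; rewrite inE in gF.
rewrite -(ltr_pM2r dg) mul1r -cE// sumr_const ltr_nat.
apply: proper_card; apply/properP; split.
  by apply/fintype.subsetP => j /andP[].
exists s; first by rewrite inE.
by apply/negP => /andP[_]; move: sS; rewrite !inE lt0n => ->.
Qed.

End GraphWeights.

(** Used to exclude [alpha = beta = m] under [non_Polya]. *)
Lemma reinforcement_mx_Polya (m : nat) : reinforcement_mx m m m = m%:M.
Proof.
by apply/matrixP => -[[|[|i]]]// hi [[|[|j]]]// hj; rewrite !mxE/= ?subnn.
Qed.

Lemma cvg_const_mx (R : realType) (n : nat) (u : nat -> 'rV[R]_n) (l : R) :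
  (forall k, u t 0 k @[t --> \oo] --> l) ->
  u t @[t --> \oo] --> (const_mx l : 'rV[R]_n).
Proof.
move=> ul; apply/cvg_ballP => e e0.
have : \forall t \near \oo, forall k, ball l e (u t 0 k).
  by apply: filter_forall => k; exact: (cvg_ball (ul k)).
by apply: filterS => t ult; split=> // i j; rewrite ord1 mxE; exact: ult.
Qed.

(** * Verification of the contraction condition and identification of the limit *)

Theorem corollary4p2
  (R : realType) (d : measure_display) (T : measurableType d)
  (P : probability T R)
  (N : nat) (E : rel 'I_N) (hE : no_isolated_vertex E)
  (m alpha beta : nat) (hm : (0 < m)%N)
  (halpha : (alpha <= m)%N) (hbeta : (beta <= m)%N)
  (W0 B0 : 'I_N -> nat) (hT0 : forall i, (1 <= W0 i + B0 i)%N)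
  (Y : nat -> 'I_N -> {RV P >-> bool})
  (hY : urn_draws E m alpha beta W0 B0 Y) :
  let S := stubborn E in
  let F := flexible E in
  let A := scaled_adj E R in
  let a : R := alpha%:R / m%:R in
  let b : R := beta%:R / m%:R in
  (forall c1 c2 : R,
     0 <= c1 <= 1 -> 0 <= c2 <= 1 ->
     rV_restrict S (initial_row R W0 B0) *m mx_block S F A = const_mx c1 ->
     const_mx 1 *m mx_block F F A = (const_mx c2 : 'rV[R]_#|F|) ->
     non_Polya R m alpha beta \/
       (S <> finset.set0 /\
        forall f, f \in F -> exists s, s \in S /\ connect E s f) ->
     flexible_cvg_as E m alpha beta W0 B0 Y
       (((1 - b) + (a + b - 1) * c1) / (1 - (a + b - 1) * c2)))
  /\
  (non_Polya R m alpha beta -> S = finset.set0 ->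
     flexible_cvg_as E m alpha beta W0 B0 Y ((1 - b) / (2 - a - b))).
Proof.
move=> S F A a b.
have m0 : 0 < m%:R :> R by rewrite ltr0n.
have main (c1 c2 : R) : 0 <= c2 <= 1 ->
    rV_restrict S (initial_row R W0 B0) *m mx_block S F A = const_mx c1 ->
    const_mx 1 *m mx_block F F A = (const_mx c2 : 'rV[R]_#|F|) ->
    non_Polya R m alpha beta \/
      (S <> finset.set0 /\
       forall f, f \in F -> exists s, s \in S /\ connect E s f) ->
    flexible_cvg_as E m alpha beta W0 B0 Y
      (((1 - b) + (a + b - 1) * c1) / (1 - (a + b - 1) * c2)).
  move=> /andP[c20 c21] hc1 hc2 hyp; set l := _ / _.
  have c1E i : i \in F -> \sum_(j in in_nbrs E i | j \in S)
      ((W0 j)%:R / (W0 j + B0 j)%:R) = c1 * (indeg E i)%:R.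
    move=> iF; rewrite -(sum_in_nbrs_block iF hc1).
    by apply: eq_bigr => j _; rewrite mxE.
  have c2E i : i \in F -> \sum_(j in in_nbrs E i | j \in F) 1
      = c2 * (indeg E i)%:R.
    move=> iF; rewrite -(@sum_in_nbrs_block _ _ _ F (const_mx 1))//.
      by apply: eq_bigr => j _; rewrite mxE.
    by rewrite -[RHS]hc2; congr (_ *m _); apply/rowP => k; rewrite !mxE.
  have : {ae P, forall x, forall i, i \in F ->
      urn_prop E m alpha beta W0 B0 Y t i x @[t --> \oo] --> l}.
    (* With no flexible vertex the claim is vacuous; otherwise [f] supplies the path needed in case
       (ii). *)
    have [F0|[f fF]] := set_0Vmem F.
      by apply: aeW => x i; rewrite F0 inE.
    have mbR : (m - beta)%:R = m%:R - beta%:R :> R by rewrite natrB.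
    have kc : `|alpha%:R - (m - beta)%:R| * c2 < m%:R :> R.
      have am : alpha%:R <= m%:R :> R by rewrite ler_nat.
      have bm : beta%:R <= m%:R :> R by rewrite ler_nat.
      rewrite mbR; case: hyp => [[nI ab0]|[_ /(_ f fF)[s [sS sf]]]].
        (* Case (i): [0 < alpha + beta < 2 * m] makes [|kappa| < m], and [c2 <= 1]. *)
        apply: le_lt_trans (_ : `|alpha%:R - (m%:R - beta%:R)| < _).
          by rewrite ler_piMr.
        have ab : 0 < alpha%:R + beta%:R :> R.
          by move: ab0; rewrite -mulrDl pmulr_lgt0// invr_gt0.
        rewrite ltr_norml; apply/andP; split; first by lra.
        have abm : (alpha + beta < m + m)%N.
          rewrite ltn_neqAle leq_add// andbT; apply/eqP => e; apply: nI.
          have [-> ->] : alpha = m /\ beta = m by lia.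
          exact: reinforcement_mx_Polya.
        by move: abm; rewrite -(ltr_nat R) !natrD; lra.
      (* Case (ii): only [|kappa| <= m] is available, and the strictness comes from [c2 < 1]. *)
      have c2lt := flexible_weight_lt1 sS fF sf c2E.
      have k1 : `|alpha%:R - (m%:R - beta%:R)| <= m%:R :> R.
        have a0 : 0 <= alpha%:R :> R by [].
        have b0 : 0 <= beta%:R :> R by [].
        by rewrite ler_norml; apply/andP; split; lra.
      apply: le_lt_trans (_ : m%:R * c2 < _); first by rewrite ler_wpM2r.
      by rewrite gtr_pMr.
    apply: (urn_cvg_as hm halpha hbeta hT0 hY kc c20 c1E c2E).
    (* The contraction condition also keeps the denominator of [l] nonzero, so that [field] can
       check the fixed-point equation. *)
    have kc' : (alpha%:R + beta%:R - m%:R) * c2 < m%:R.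
      apply: le_lt_trans kc; rewrite mbR opprB addrCA [_ + (_ - _)]addrC.
      by rewrite ler_wpM2r// (le_trans _ (ler_norm _))//; lra.
    rewrite mbR /l /a /b.
    field.
    by apply/andP; split; apply: lt0r_neq0; lra.
  apply: filterS => x cvgx; apply: cvg_const_mx => k.
  rewrite [X in X @ _ --> _](_ : _ = fun t =>
    urn_prop E m alpha beta W0 B0 Y t (enum_val k) x); last first.
    by apply/funext => t; rewrite !mxE.
  by apply: cvgx; exact: enum_valP.
split=> [c1 c2 _ c2I hc1 hc2 hyp|nP S0]; first exact: main.
(* Without stubborn vertices the first part applies with [c1 = 0] (an empty sum) and [c2 = 1]
   ([indeg] terms equal to [1 / indeg]). *)
rewrite [_ / _](_ : _ =
    ((1 - b) + (a + b - 1) * 0) / (1 - (a + b - 1) * 1)); last first.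
  by rewrite mulr0 addr0 mulr1; congr (_ / _); ring.
have SF i : i \in F.
  by move/setP/(_ i) : S0; rewrite !inE lt0n => ->.
apply: main; [by rewrite ler01 lexx| | |by left].
- apply/rowP => k; rewrite !mxE big1// => i.
  have := ltn_ord i; rewrite [X in (_ < X)%N](eq_card0 (A := S))// => j.
  by rewrite S0 inE.
- apply/rowP => k; set j := enum_val k; rewrite !mxE.
  have dj : (indeg E j)%:R != 0 :> R.
    by rewrite pnatr_eq0 -lt0n; have := SF j; rewrite inE.
  transitivity (\sum_(i in F) scaled_adj E R i j).
    by rewrite [RHS]big_enum_val; apply: eq_bigr => i _; rewrite !mxE mul1r.
  transitivity (\sum_(i in in_nbrs E j) (indeg E j)%:R^-1 : R).
    rewrite [LHS]big_mkcond [RHS]big_mkcond/=.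
    by apply: eq_bigr => i _; rewrite SF mxE inE.
  by rewrite sumr_const -[LHS]mulr_natr mulVf.
Qed.
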